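(* The generators of the Frobenius algebras $\mathcal G$ and $\mathcal W$ on $\mathbb C^2$, along with single-qubit states, are universal for quantum computation: for every $N\ge1$, every unitary map on $(\mathbb C^2)^{\otimes N}$ can (up to a global phase) be obtained by composition and tensor product from identities and swap maps on $\mathbb C^2$, the eight linear maps generating $\mathcal G$ and $\mathcal W$, and single-qubit states $|\psi\rangle:\mathbb C\to\mathbb C^2$.
   Context: Let $|0\rangle,|1\rangle$ be the standard basis of $\mathbb C^2$. The generators of $\mathcal G$ (the commutative Frobenius algebra induced by the GHZ state) are $$|0\rangle\langle00|+|1\rangle\langle11|,\quad |0\rangle+|1\rangle,\quad |00\rangle\langle0|+|11\rangle\langle1|,\quad \langle0|+\langle1|$$ (multiplication, unit, comultiplication, counit). The generators of $\mathcal W$ (induced by the W state) are $$|1\rangle\langle11|+|0\rangle\langle01|+|0\rangle\langle10|,\quad |1\rangle,\quad |00\rangle\langle0|+|01\rangle\langle1|+|10\rangle\langle1|,\quad \langle0|$$ (multiplication, unit, comultiplication, counit). A single-qubit state is a vector $|\psi\rangle\in\mathbb C^2$, regarded as a linear map $\mathbb C\to\mathbb C^2$ (normalisation is ignored). A set of maps is called universal for quantum computation if any $N$-qubit unitary map can be constructed from compositions of those maps; operators differing only by a global phase are identified. *)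

(* Defs.v *)
From mathcomp Require Import all_boot all_order all_algebra.
From mathcomp Require Import reals complex mxtens spectral.

Set Implicit Arguments.
Unset Strict Implicit.
Unset Printing Implicit Defensive.

Import GRing.Theory Num.Theory.
Local Open Scope ring_scope.

(* A linear map (C^2)^{(x) n} -> (C^2)^{(x) m}, with C = R[i], is given by its
   matrix in 'M_(2 ^ m, 2 ^ n) acting on column vectors: rows are outputs,
   columns are inputs, and composition B o A is B *m A.  The basis vector
   |b_1 ... b_k> has index the number with binary digits b_1 ... b_k, b_1 being
   the most significant; this is the convention of [tensmx]. *)

Definition qtens (R : realType) (m n p q : nat)
    (A : 'M[R[i]]_(2 ^ m, 2 ^ n)) (B : 'M[R[i]]_(2 ^ p, 2 ^ q)) :
    'M[R[i]]_(2 ^ (m + p), 2 ^ (n + q)) :=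
  castmx (esym (expnD 2 m p), esym (expnD 2 n q)) (tensmx A B).

Section Generators.
Variable R : realType.

Definition ket (i : 'I_2) : 'M[R[i]]_(2 ^ 1, 2 ^ 0) := delta_mx i ord0.
Definition bra (i : 'I_2) : 'M[R[i]]_(2 ^ 0, 2 ^ 1) := delta_mx ord0 i.
Definition ket2 (i j : 'I_2) : 'M[R[i]]_(2 ^ 2, 2 ^ 0) := qtens (ket i) (ket j).
Definition bra2 (i j : 'I_2) : 'M[R[i]]_(2 ^ 0, 2 ^ 2) := qtens (bra i) (bra j).

Definition swap : 'M[R[i]]_(2 ^ 2, 2 ^ 2) :=
  \sum_(i < 2) \sum_(j < 2) ket2 j i *m bra2 i j.

Definition ghz_mul : 'M[R[i]]_(2 ^ 1, 2 ^ 2) :=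
  ket 0 *m bra2 0 0 + ket 1 *m bra2 1 1.
Definition ghz_unit : 'M[R[i]]_(2 ^ 1, 2 ^ 0) := ket 0 + ket 1.
Definition ghz_comul : 'M[R[i]]_(2 ^ 2, 2 ^ 1) :=
  ket2 0 0 *m bra 0 + ket2 1 1 *m bra 1.
Definition ghz_counit : 'M[R[i]]_(2 ^ 0, 2 ^ 1) := bra 0 + bra 1.

Definition w_mul : 'M[R[i]]_(2 ^ 1, 2 ^ 2) :=
  ket 1 *m bra2 1 1 + ket 0 *m bra2 0 1 + ket 0 *m bra2 1 0.
Definition w_unit : 'M[R[i]]_(2 ^ 1, 2 ^ 0) := ket 1.
Definition w_comul : 'M[R[i]]_(2 ^ 2, 2 ^ 1) :=
  ket2 0 0 *m bra 0 + ket2 0 1 *m bra 1 + ket2 1 0 *m bra 1.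
Definition w_counit : 'M[R[i]]_(2 ^ 0, 2 ^ 1) := bra 0.

End Generators.

Inductive ghz_generator (R : realType) :
    forall m n : nat, 'M[R[i]]_(2 ^ m, 2 ^ n) -> Prop :=
  | GhzMul : @ghz_generator R 1 2 (ghz_mul R)
  | GhzUnit : @ghz_generator R 1 0 (ghz_unit R)
  | GhzComul : @ghz_generator R 2 1 (ghz_comul R)
  | GhzCounit : @ghz_generator R 0 1 (ghz_counit R).

Inductive w_generator (R : realType) :
    forall m n : nat, 'M[R[i]]_(2 ^ m, 2 ^ n) -> Prop :=
  | WMul : @w_generator R 1 2 (w_mul R)
  | WUnit : @w_generator R 1 0 (w_unit R)
  | WComul : @w_generator R 2 1 (w_comul R)
  | WCounit : @w_generator R 0 1 (w_counit R).

(* States are not required to be normalised. *)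
Inductive single_qubit_state (R : realType) :
    forall m n : nat, 'M[R[i]]_(2 ^ m, 2 ^ n) -> Prop :=
  | SingleQubitState (psi : 'M[R[i]]_(2 ^ 1, 2 ^ 0)) :
      @single_qubit_state R 1 0 psi.

Inductive constructible (R : realType)
    (G : forall m n : nat, 'M[R[i]]_(2 ^ m, 2 ^ n) -> Prop) :
    forall m n : nat, 'M[R[i]]_(2 ^ m, 2 ^ n) -> Prop :=
  | ConstrGen m n (A : 'M[R[i]]_(2 ^ m, 2 ^ n)) :
      G m n A -> @constructible R G m n A
  | ConstrId : @constructible R G 1 1 1%:M
  | ConstrSwap : @constructible R G 2 2 (swap R)
  | ConstrComp m n p
      (B : 'M[R[i]]_(2 ^ m, 2 ^ n)) (A : 'M[R[i]]_(2 ^ n, 2 ^ p)) :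
      @constructible R G m n B -> @constructible R G n p A ->
      @constructible R G m p (B *m A)
  | ConstrTens m n p q
      (A : 'M[R[i]]_(2 ^ m, 2 ^ n)) (B : 'M[R[i]]_(2 ^ p, 2 ^ q)) :
      @constructible R G m n A -> @constructible R G p q B ->
      @constructible R G (m + p) (n + q) (qtens A B).

(* The scalar c accounts for the identification of operators that differ only
   by a global phase. *)
Definition universal (R : realType)
    (G : forall m n : nat, 'M[R[i]]_(2 ^ m, 2 ^ n) -> Prop) : Prop :=
  forall (N : nat) (U : 'M[R[i]]_(2 ^ N, 2 ^ N)),
    (1 <= N)%N -> U \is unitarymx ->
    exists c : R[i], `|c| = 1 /\ @constructible R G N N (c *: U).

(* Main.v *)
(* Every matrix on N qubits, unitary or not, is constructible, so no phase is
   needed.  Call D controllable if some constructible F : 1 + N -> N satisfies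
   F (|0> (x) v) = v and F (|1> (x) v) = D v.  Given controlled versions of D
   and E, running both with the control wire copied by the GHZ comultiplication
   gives D E, while splitting the control by the W comultiplication,
   |1> |-> |01> + |10>, gives D + E.  Hence controllable matrices form an
   algebra; it contains the scalars (GHZ multiplication by |0> + a|1>, then the
   counit) and |0><1| on one qubit (W multiplication, after a NOT on the
   control), and it is closed under tensoring with identities, so it contains
   everything. *)
Require Import Defs.
From mathcomp Require Import all_boot all_order all_algebra.
From mathcomp Require Import reals complex mxtens spectral.

Set Implicit Arguments.
Unset Strict Implicit.
Unset Printing Implicit Defensive.

Import GRing.Theory Num.Theory.
Local Open Scope ring_scope.

Section QubitTensor.
Variable R : realType.
Local Notation C := R[i].
Local Notation "A *q B" := (qtens A B) (at level 40, left associativity).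

(** * Algebra of the qubit tensor product [qtens] *)

Lemma mulmx_castmx (m m' n n' p p' : nat) (em : m = m') (en : n = n')
    (ep : p = p') (A : 'M[C]_(m, n)) (B : 'M[C]_(n, p)) :
  castmx (em, en) A *m castmx (en, ep) B = castmx (em, ep) (A *m B).
Proof. by case: m' / em; case: n' / en; case: p' / ep. Qed.

Lemma qtens_mul m n p m' n' p' (A : 'M[C]_(2 ^ m, 2 ^ n))
    (B : 'M[C]_(2 ^ m', 2 ^ n')) (A' : 'M[C]_(2 ^ n, 2 ^ p))
    (B' : 'M[C]_(2 ^ n', 2 ^ p')) :
  (A *q B) *m (A' *q B') = (A *m A') *q (B *m B').
Proof. by rewrite /qtens mulmx_castmx tensmx_mul. Qed.

Lemma tensmxDl m n p q (A B : 'M[C]_(m, n)) (D : 'M[C]_(p, q)) :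
  tensmx (A + B) D = tensmx A D + tensmx B D.
Proof. by apply/matrixP=> i j; rewrite !mxE mulrDl. Qed.

Lemma tensmxDr m n p q (D : 'M[C]_(m, n)) (A B : 'M[C]_(p, q)) :
  tensmx D (A + B) = tensmx D A + tensmx D B.
Proof. by apply/matrixP=> i j; rewrite !mxE mulrDr. Qed.

Lemma qtensDl m n p q (A B : 'M[C]_(2 ^ m, 2 ^ n)) (D : 'M[C]_(2 ^ p, 2 ^ q)) :
  (A + B) *q D = A *q D + B *q D.
Proof.
by rewrite /qtens tensmxDl; apply/matrixP=> i j; rewrite !(mxE, castmxE).
Qed.

Lemma qtensDr m n p q (D : 'M[C]_(2 ^ m, 2 ^ n)) (A B : 'M[C]_(2 ^ p, 2 ^ q)) :
  D *q (A + B) = D *q A + D *q B.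
Proof.
by rewrite /qtens tensmxDr; apply/matrixP=> i j; rewrite !(mxE, castmxE).
Qed.

Lemma qtens1 m n : 1%:M *q 1%:M = 1%:M :> 'M[C]_(2 ^ (m + n)).
Proof.
rewrite /qtens; apply/matrixP=> i j; rewrite castmxE.
set i' := cast_ord _ i; set j' := cast_ord _ j.
have -> : (1%:M : 'M[C]_(2 ^ (m + n))) i j = 1%:M i' j'.
  by rewrite !mxE (inj_eq (@cast_ord_inj _ _ _)).
case: (mxtens_indexP i')=> a b; case: (mxtens_indexP j')=> c d.
rewrite tensmxE !mxE (inj_eq (can_inj (@mxtens_indexK _ _))) xpair_eqE.
by rewrite -natrM mulnb.
Qed.

Lemma qtens_scalar0 (a : C) n p (A : 'M[C]_(2 ^ n, 2 ^ p)) :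
  qtens (a%:M : 'M_(2 ^ 0, 2 ^ 0)) A = a *: A.
Proof. by rewrite /qtens tens_scalar_mx castmx_comp; exact: castmx_id. Qed.

(** For variable [n], [n + 0] does not reduce to [n], so a cast remains here, unlike with the empty
    factor on the left. It disappears by [castmx_id] once the sizes are numerals. *)
Lemma qtens_1r0 (n p : nat) (A : 'M[C]_(2 ^ n, 2 ^ p)) :
  qtens A (1%:M : 'M_(2 ^ 0, 2 ^ 0)) =
  castmx (congr1 (expn 2) (esym (addn0 n)), congr1 (expn 2) (esym (addn0 p))) A.
Proof.
rewrite /qtens tens_mx_scalar castmx_comp scale1r.
by congr (castmx _ _); congr (_, _); exact: nat_irrelevance.
Qed.

Lemma tensmxA m n p q r s (A : 'M[C]_(m, n)) (B : 'M[C]_(p, q))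
    (D : 'M[C]_(r, s)) :
  tensmx (tensmx A B) D =
  castmx (mulnA m p r, mulnA n q s) (tensmx A (tensmx B D)).
Proof.
apply/matrixP=> i j.
case: (mxtens_indexP i)=> ij k; case: (mxtens_indexP ij)=> {ij} i1 i2.
case: (mxtens_indexP j)=> ij l; case: (mxtens_indexP ij)=> {ij} j1 j2.
rewrite castmxE !tensmxE.
(* Both nestings encode the same mixed-radix number [x * v * w + y * w + z]. *)
have reassoc u v w (x : 'I_u) (y : 'I_v) (z : 'I_w) :
    cast_ord (esym (mulnA u v w)) (mxtens_index (mxtens_index (x, y), z)) =
    mxtens_index (x, mxtens_index (y, z)).
  by apply: val_inj; rewrite /= mulnDl mulnA addnA.
by rewrite !reassoc !tensmxE mulrA.
Qed.

Lemma tensmx_castmx (m m' n n' p p' q q' : nat) (em : m = m') (en : n = n')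
    (ep : p = p') (eq : q = q') (A : 'M[C]_(m, n)) (B : 'M[C]_(p, q)) :
  tensmx (castmx (em, en) A) (castmx (ep, eq) B) =
  castmx (congr2 muln em ep, congr2 muln en eq) (tensmx A B).
Proof.
case: m' / em; case: n' / en; case: p' / ep; case: q' / eq.
by rewrite !castmx_id.
Qed.

Lemma qtensA m n p q r s (A : 'M[C]_(2 ^ m, 2 ^ n)) (B : 'M[C]_(2 ^ p, 2 ^ q))
    (D : 'M[C]_(2 ^ r, 2 ^ s)) :
  A *q B *q D =
  castmx (congr1 (expn 2) (addnA m p r), congr1 (expn 2) (addnA n q s))
    (A *q (B *q D)).
Proof.
rewrite /qtens -[D in LHS](castmx_id (erefl, erefl)).
rewrite -[A in RHS](castmx_id (erefl, erefl)) !tensmx_castmx tensmxA.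
rewrite !castmx_comp.
by congr (castmx _ _); congr (_, _); exact: nat_irrelevance.
Qed.

(** When the left factors have numeral sizes, both bracketings have convertible types, so the cast
    of [qtensA] is trivial. *)
Lemma qtensA1010 r s (A B : 'M[C]_(2 ^ 1, 2 ^ 0)) (D : 'M[C]_(2 ^ r, 2 ^ s)) :
  A *q B *q D = A *q (B *q D).
Proof. by rewrite qtensA; exact: castmx_id. Qed.

Lemma qtensA1011 r s (A : 'M[C]_(2 ^ 1, 2 ^ 0)) (B : 'M[C]_(2 ^ 1, 2 ^ 1))
  (D : 'M[C]_(2 ^ r, 2 ^ s)) :
  A *q B *q D = A *q (B *q D).
Proof. by rewrite qtensA; exact: castmx_id. Qed.

Lemma qtensA1110 r s (A : 'M[C]_(2 ^ 1, 2 ^ 1)) (B : 'M[C]_(2 ^ 1, 2 ^ 0))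
  (D : 'M[C]_(2 ^ r, 2 ^ s)) :
  A *q B *q D = A *q (B *q D).
Proof. by rewrite qtensA; exact: castmx_id. Qed.

Local Notation ket := (ket R).
Local Notation bra := (bra R).

(** * Action of the generators and of the swap on basis kets *)

Lemma ord2_cases (b : 'I_2) : b = 0 \/ b = 1.
Proof. by case: b => [[|[|b]] lt_b2] //; [left | right]; apply: val_inj. Qed.

Lemma bra_ket i j : bra i *m ket j = (i == j)%:R%:M.
Proof.
by rewrite /bra /ket mul_delta_mx_cond [delta_mx _ _]mx11_scalar mxE -raddfMn.
Qed.

Lemma ket_bra_sum : ket 0 *m bra 0 + ket 1 *m bra 1 = 1%:M.
Proof.
rewrite /bra /ket !mul_delta_mx; apply/matrixP=> x y; rewrite !mxE.
by case: (ord2_cases x) => ->; case: (ord2_cases y) => ->;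
  rewrite ?addr0 ?add0r.
Qed.

Lemma eq_mx_ket n (A B : 'M[C]_(2 ^ n, 2 ^ 1)) :
  A *m ket 0 = B *m ket 0 -> A *m ket 1 = B *m ket 1 -> A = B.
Proof.
move=> e0 e1; rewrite -[A]mulmx1 -[B]mulmx1 -ket_bra_sum !mulmxDr !mulmxA.
by rewrite e0 e1.
Qed.

Lemma bra2_ket_qtens i j k p (A : 'M[C]_(2 ^ 1, 2 ^ p)) :
  bra2 R i j *m (ket k *q A) = (i == k)%:R *: (bra j *m A).
Proof.
by rewrite /bra2 (qtens_mul (bra i) (bra j) (ket k) A) bra_ket qtens_scalar0.
Qed.

(** Separates preparing the control from acting on the other wires, so that facts about
    [ket b *q 1%:M] become applicable. *)
Lemma ket_qtens n p b (A : 'M[C]_(2 ^ n, 2 ^ p)) :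
  ket b *q A = (ket b *q 1%:M) *m A.
Proof.
rewrite -[A in RHS]scale1r -qtens_scalar0.
by rewrite (qtens_mul (ket b) 1%:M 1%:M A) mulmx1 mul1mx.
Qed.

Lemma w_comul_ket0 : w_comul R *m ket 0 = ket 0 *q ket 0.
Proof.
rewrite /w_comul !mulmxDl -!mulmxA !bra_ket !mul_mx_scalar.
by rewrite !(scale0r, scale1r) !addr0.
Qed.

Lemma w_comul_ket1 : w_comul R *m ket 1 = ket 0 *q ket 1 + ket 1 *q ket 0.
Proof.
rewrite /w_comul !mulmxDl -!mulmxA !bra_ket !mul_mx_scalar.
by rewrite !(scale0r, scale1r) !add0r.
Qed.

Lemma ghz_comul_ket b : ghz_comul R *m ket b = ket b *q ket b.
Proof.
rewrite /ghz_comul !mulmxDl -!mulmxA !bra_ket !mul_mx_scalar.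
by case: (ord2_cases b) => ->; rewrite !(scale0r, scale1r, addr0, add0r).
Qed.

Lemma w_mul_ket_qtens b : w_mul R *m (ket b *q 1%:M) =
  (b == 1)%:R *: (ket 1 *m bra 1) + (b == 0)%:R *: (ket 0 *m bra 1) +
  (b == 1)%:R *: (ket 0 *m bra 0).
Proof.
rewrite /w_mul 2!mulmxDl -3!mulmxA 3!bra2_ket_qtens 2!mulmx1 -3!scalemxAr.
by rewrite ![_ == b]eq_sym.
Qed.

(** With [w_mul_ket1], this exhibits [w_mul] as a controlled gate of reversed polarity: it acts on
    control 0 and is the identity on control 1. *)
Lemma w_mul_ket0 : w_mul R *m (ket 0 *q 1%:M) = ket 0 *m bra 1.
Proof. by rewrite w_mul_ket_qtens !(scale0r, scale1r, add0r, addr0). Qed.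

Lemma w_mul_ket1 : w_mul R *m (ket 1 *q 1%:M) = 1%:M.
Proof.
by rewrite w_mul_ket_qtens !(scale0r, scale1r, addr0) addrC ket_bra_sum.
Qed.

Lemma ghz_mul_ket b : ghz_mul R *m (ket b *q 1%:M) = ket b *m bra b.
Proof.
rewrite /ghz_mul !mulmxDl -!mulmxA !bra2_ket_qtens !mulmx1.
by case: (ord2_cases b) => ->;
  rewrite !(scale0r, scale1r, mulmx0, add0r, addr0).
Qed.

Lemma swap_ket b c : swap R *m (ket b *q ket c) = ket c *q ket b.
Proof.
rewrite /swap mulmx_suml (bigD1 b) //= mulmx_suml (bigD1 c) //=.
rewrite -mulmxA bra2_ket_qtens bra_ket !eqxx scale1r mulmx1.
rewrite !big1 ?addr0 // => [i ib|i ic].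
  rewrite mulmx_suml big1 // => j _.
  by rewrite -mulmxA bra2_ket_qtens (negPf ib) scale0r mulmx0.
by rewrite -mulmxA bra2_ket_qtens bra_ket (negPf ic) raddf0 scaler0 mulmx0.
Qed.

Lemma swap_ket_id b : swap R *m (ket b *q 1%:M) = (1%:M : 'M_(2 ^ 1)) *q ket b.
Proof.
(* An empty right factor makes the interchange law [qtens_mul] applicable. *)
have ketr c : ket c = ket c *q (1%:M : 'M[C]_(2 ^ 0)).
  by rewrite qtens_1r0; symmetry; exact: castmx_id.
suff eqk c : swap R *m (ket b *q 1%:M) *m ket c =
    (1%:M : 'M_(2 ^ 1)) *q ket b *m ket c.
  exact: eq_mx_ket.
rewrite -mulmxA -ket_qtens swap_ket [ket c in RHS]ketr.
by rewrite (qtens_mul 1%:M (ket b) (ket c) 1%:M) mul1mx mulmx1.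
Qed.

End QubitTensor.

Section Controlled.
Variable R : realType.
Local Notation C := R[i].
Local Notation "A *q B" := (qtens A B) (at level 40, left associativity).
Local Notation ket := (ket R).
Local Notation bra := (bra R).

(** * Basic constructible maps *)

Definition ghz_w_state (m n : nat) (A : 'M[C]_(2 ^ m, 2 ^ n)) : Prop :=
  ghz_generator A \/ w_generator A \/ single_qubit_state A.

Local Notation constr m n A := (@constructible R ghz_w_state m n A).

Lemma constr_state psi : constr 1 0 psi.
Proof. by apply: ConstrGen; right; right; constructor. Qed.

Lemma constr_w_mul : constr 1 2 (w_mul R).
Proof. by apply: ConstrGen; right; left; constructor. Qed.

Lemma constr_w_comul : constr 2 1 (w_comul R).
Proof. by apply: ConstrGen; right; left; constructor. Qed.

Lemma constr_ghz_mul : constr 1 2 (ghz_mul R).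
Proof. by apply: ConstrGen; left; constructor. Qed.

Lemma constr_ghz_comul : constr 2 1 (ghz_comul R).
Proof. by apply: ConstrGen; left; constructor. Qed.

Lemma constr_ghz_counit : constr 0 1 (ghz_counit R).
Proof. by apply: ConstrGen; left; constructor. Qed.

Lemma ghz_counit_ket b : ghz_counit R *m ket b = 1%:M.
Proof.
rewrite /ghz_counit mulmxDl !bra_ket -raddfD /=.
by case: (ord2_cases b) => ->; rewrite ?addr0 ?add0r.
Qed.

Lemma constr_id n : constr n n 1%:M.
Proof.
elim: n => [|n IH]; last first.
  by rewrite -(qtens1 R 1 n); exact: ConstrTens (ConstrId _) IH.
(* The identity on zero wires is the scalar 1, obtained by closing off a ket with the GHZ counit. *)
rewrite -(ghz_counit_ket 0).
exact: ConstrComp constr_ghz_counit (constr_state _).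
Qed.

(** * Controllable matrices and their closure properties *)

Definition controllable n (D : 'M[C]_(2 ^ n)) : Prop :=
  exists F : 'M[C]_(2 ^ n, 2 ^ (1 + n)), [/\ constr n (1 + n) F,
    F *m (ket 0 *q 1%:M) = 1%:M & F *m (ket 1 *q 1%:M) = D].

(** Feed the state [ket 1] to the control wire. *)
Lemma controllable_constructible n (D : 'M[C]_(2 ^ n)) :
  controllable D -> constr n n D.
Proof.
case=> F [cF _ <-]; apply: ConstrComp cF _.
exact: ConstrTens (constr_state _) (constr_id n).
Qed.

(** The two controls sit side by side in front: [G] consumes the inner one [c], then [F] the outer
    one [b]. A 1-to-2 map on a single control later supplies both. *)
Lemma controlled_comp n (F G : 'M[C]_(2 ^ n, 2 ^ (1 + n))) b c :
  F *m (1%:M *q G) *m (ket b *q ket c *q 1%:M) =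
  F *m (ket b *q 1%:M) *m (G *m (ket c *q 1%:M)).
Proof.
by rewrite qtensA1010 -mulmxA (qtens_mul 1%:M G) mul1mx
 (ket_qtens b (G *m _)) mulmxA.
Qed.

Lemma constr_controlled_comp n (F G : 'M[C]_(2 ^ n, 2 ^ (1 + n)))
    (delta : 'M[C]_(2 ^ 2, 2 ^ 1)) :
  constr n (1 + n) F ->
  constr n (1 + n) G ->
  constr 2 1 delta ->
  constr n (1 + n) (F *m (1%:M *q G) *m (delta *q 1%:M)).
Proof.
move=> cF cG cd; apply: (@ConstrComp _ _ n (2 + n) (1 + n)).
  apply: ConstrComp cF _; exact: ConstrTens (ConstrId _) cG.
exact: ConstrTens cd (constr_id n).
Qed.

Lemma controllableD n (D E : 'M[C]_(2 ^ n)) :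
  controllable D -> controllable E -> controllable (D + E).
Proof.
move=> [F [cF F0 F1]] [G [cG G0 G1]].
exists (F *m (1%:M *q G) *m (w_comul R *q 1%:M)); split.
- exact: constr_controlled_comp cF cG constr_w_comul.
- by rewrite -mulmxA (qtens_mul (w_comul R) 1%:M (ket 0)) w_comul_ket0 mul1mx
    controlled_comp F0 G0 mulmx1.
rewrite -mulmxA (qtens_mul (w_comul R) 1%:M (ket 1)) w_comul_ket1 mul1mx.
(* Each term of [|01> + |10>] triggers exactly one of the two maps, giving [E] and [D]. *)
rewrite qtensDl mulmxDr !controlled_comp.
by rewrite F0 G0 F1 G1 mul1mx mulmx1 addrC.
Qed.

Lemma controllableM n (D E : 'M[C]_(2 ^ n)) :
  controllable D -> controllable E -> controllable (D *m E).
Proof.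
move=> [F [cF F0 F1]] [G [cG G0 G1]].
exists (F *m (1%:M *q G) *m (ghz_comul R *q 1%:M)); split.
- exact: constr_controlled_comp cF cG constr_ghz_comul.
- by rewrite -mulmxA (qtens_mul (ghz_comul R) 1%:M (ket 0)) ghz_comul_ket mul1mx
    controlled_comp F0 G0 mulmx1.
by rewrite -mulmxA (qtens_mul (ghz_comul R) 1%:M (ket 1)) ghz_comul_ket mul1mx
  controlled_comp F1 G1.
Qed.

Lemma controllable_scalar n (a : C) : controllable (a%:M : 'M_(2 ^ n)).
Proof.
(* GHZ multiplication by [psi] is the diagonal map with entries 1 and [a]; the counit then turns it
   into the covector [e], which weighs control 0 by 1 and control 1 by [a]. *)
pose psi := ket 0 + a *: ket 1.
pose e := ghz_counit R *m (ghz_mul R *m (psi *q (1%:M : 'M_(2 ^ 1)))).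
have e_ket : e = bra 0 + a *: bra 1.
  rewrite /e; have -> : psi *q (1%:M : 'M_(2 ^ 1)) =
      ket 0 *q 1%:M + ket 1 *q (a%:M : 'M_(2 ^ 1)).
    rewrite /psi qtensDl; congr (_ + _).
    by rewrite [RHS]ket_qtens mul_mx_scalar /qtens; apply/matrixP=> i j;
      rewrite !(mxE, castmxE) mulrA.
  rewrite mulmxDr [ket 1 *q a%:M]ket_qtens [ghz_mul R *m (_ *m _)]mulmxA.
  by rewrite !ghz_mul_ket mul_mx_scalar mulmxDr -scalemxAr !mulmxA
    !ghz_counit_ket !mul1mx.
exists (e *q 1%:M); split.
- apply: (@ConstrTens _ _ 0 1 n n) (constr_id n).
  apply: ConstrComp constr_ghz_counit _; apply: ConstrComp constr_ghz_mul _.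
  exact: ConstrTens (constr_state psi) (ConstrId _).
- rewrite (qtens_mul e 1%:M (ket 0)) e_ket mulmxDl -scalemxAl !bra_ket.
  by rewrite raddf0 scaler0 addr0 qtens_scalar0 mulmx1 scale1r.
rewrite (qtens_mul e 1%:M (ket 1)) e_ket mulmxDl -scalemxAl !bra_ket.
by rewrite raddf0 add0r scale_scalar_mx qtens_scalar0 mulmx1 mulr1
  scale_scalar_mx mulr1.
Qed.

Lemma controllable_qtensr n (E : 'M[C]_(2 ^ 1)) :
  controllable E -> controllable (E *q (1%:M : 'M_(2 ^ n))).
Proof.
case=> F [cF F0 F1]; exists (F *q (1%:M : 'M_(2 ^ n))); split.
- exact: ConstrTens cF (constr_id n).
- by rewrite -qtens1 -qtensA1011 (qtens_mul F 1%:M (ket 0 *q 1%:M)) F0 mulmx1.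
- by rewrite -qtens1 -qtensA1011 (qtens_mul F 1%:M (ket 1 *q 1%:M)) F1 mulmx1.
Qed.

(** The control wire enters first, so it must be swapped past the idle qubit before reaching the map
    that controls [D]. *)
Lemma controllable_qtensl n (D : 'M[C]_(2 ^ n)) :
  controllable D -> controllable ((1%:M : 'M_(2 ^ 1)) *q D).
Proof.
case=> F [cF F0 F1].
have eF b : (1%:M : 'M_(2 ^ 1)) *q F *m (swap R *q 1%:M) *m (ket b *q 1%:M) =
    1%:M *q (F *m (ket b *q 1%:M)).
  rewrite -mulmxA -(qtens1 R 1 n) -qtensA1011.
  rewrite (qtens_mul (swap R) 1%:M (ket b *q 1%:M)) swap_ket_id mulmx1.
  by rewrite qtensA1110 (qtens_mul 1%:M F 1%:M) mulmx1.
exists ((1%:M : 'M_(2 ^ 1)) *q F *m (swap R *q 1%:M)); split.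
- apply: (@ConstrComp _ _ (1 + n) (2 + n) (2 + n)).
    exact: ConstrTens (ConstrId _) cF.
  exact: ConstrTens (ConstrSwap _) (constr_id n).
- by rewrite eF F0 qtens1.
- by rewrite eF F1.
Qed.

(** * The NOT gate and the one-qubit matrix units *)

Definition pauliX : 'M[C]_(2 ^ 1) := ket 1 *m bra 0 + ket 0 *m bra 1.

Lemma pauliX_ket0 : pauliX *m ket 0 = ket 1.
Proof.
rewrite /pauliX mulmxDl -!mulmxA !bra_ket !mul_mx_scalar.
by rewrite scale1r scale0r addr0.
Qed.

Lemma pauliX_ket1 : pauliX *m ket 1 = ket 0.
Proof.
rewrite /pauliX mulmxDl -!mulmxA !bra_ket !mul_mx_scalar.
by rewrite scale1r scale0r add0r.
Qed.

Lemma pauliXX : pauliX *m pauliX = 1%:M.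
Proof.
by apply: eq_mx_ket; rewrite -mulmxA !(pauliX_ket0, pauliX_ket1) mul1mx.
Qed.

(* The cup |01> + |10> of W bent by the cap <00| + <11| of GHZ. *)
Lemma constr_pauliX : constr 1 1 pauliX.
Proof.
pose cap : 'M[C]_(2 ^ 0, 2 ^ 2) := ghz_counit R *m ghz_mul R.
pose cup : 'M[C]_(2 ^ 2, 2 ^ 0) := w_comul R *m ket 1.
pose left : 'M[C]_(2 ^ 1, 2 ^ 3) := cap *q (1%:M : 'M_(2 ^ 1)).
pose right : 'M[C]_(2 ^ 3, 2 ^ 1) := (1%:M : 'M_(2 ^ 1)) *q cup.
have cap_ket b c : cap *m (ket b *q ket c) = (b == c)%:R%:M.
  by rewrite /cap -mulmxA [ket b *q ket c]ket_qtens [ghz_mul R *m _]mulmxA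
    ghz_mul_ket !mulmxA ghz_counit_ket mul1mx bra_ket.
have left_ket b c d : left *m (ket b *q (ket c *q ket d)) =
    (b == c)%:R *: ket d.
  by rewrite -qtensA1010 (qtens_mul cap 1%:M (ket b *q ket c)) cap_ket
    qtens_scalar0 mul1mx.
have right_ket b : right *m ket b =
    ket b *q (ket 0 *q ket 1) + ket b *q (ket 1 *q ket 0).
  have {1}-> : ket b = ket b *q (1%:M : 'M[C]_(2 ^ 0)).
    by rewrite qtens_1r0; symmetry; exact: castmx_id.
  rewrite (qtens_mul 1%:M cup (ket b) 1%:M) mul1mx mulmx1.
  by rewrite /cup w_comul_ket1 qtensDr.
have -> : pauliX = left *m right.
  apply: eq_mx_ket; rewrite -mulmxA right_ket mulmxDr !left_ket.
    by rewrite pauliX_ket0 scale1r scale0r addr0.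
  by rewrite pauliX_ket1 scale1r scale0r add0r.
apply: (@ConstrComp _ _ 1 3 1).
  apply: (@ConstrTens _ _ 0 2 1 1) (ConstrId _).
  exact: ConstrComp constr_ghz_counit constr_ghz_mul.
apply: (@ConstrTens _ _ 1 1 2 0) (ConstrId _) _.
exact: ConstrComp constr_w_comul (constr_state _).
Qed.

Lemma controllable01 : controllable (ket 0 *m bra 1 : 'M_(2 ^ 1)).
Proof.
exists (w_mul R *m (pauliX *q (1%:M : 'M_(2 ^ 1)))); split.
- apply: ConstrComp constr_w_mul _.
  exact: ConstrTens constr_pauliX (ConstrId _).
- by rewrite -mulmxA (qtens_mul pauliX 1%:M (ket 0)) pauliX_ket0 mul1mx
    w_mul_ket1.
- by rewrite -mulmxA (qtens_mul pauliX 1%:M (ket 1)) pauliX_ket1 mul1mx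
    w_mul_ket0.
Qed.

Lemma controllable10 : controllable (ket 1 *m bra 0 : 'M_(2 ^ 1)).
Proof.
have [F [cF F0 F1]] := controllable01.
have eF b : pauliX *m F *m ((1%:M : 'M_(2 ^ 1)) *q pauliX) *m (ket b *q 1%:M) =
    pauliX *m (F *m (ket b *q 1%:M)) *m pauliX.
  rewrite -!mulmxA (qtens_mul 1%:M pauliX (ket b) 1%:M) mul1mx mulmx1.
  by rewrite [ket b *q pauliX]ket_qtens.
(* Conjugating the target by the involution [pauliX] keeps the control-0 branch equal to the
   identity and exchanges the two off-diagonal matrix units. *)
exists (pauliX *m F *m ((1%:M : 'M_(2 ^ 1)) *q pauliX)); split.
- apply: (@ConstrComp _ _ 1 2 2).
    exact: ConstrComp constr_pauliX cF.
  exact: (@ConstrTens _ _ 1 1 1 1) (ConstrId _) constr_pauliX.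
- by rewrite eF F0 mulmx1 pauliXX.
rewrite eF F1; apply: eq_mx_ket; rewrite -!mulmxA ?pauliX_ket0 ?pauliX_ket1.
  by rewrite !bra_ket !mul_mx_scalar !scale1r pauliX_ket0.
by rewrite !bra_ket !mul_mx_scalar !scale0r mulmx0.
Qed.

(** The diagonal units are products of the two off-diagonal ones. *)
Lemma controllable_ket_bra b c : controllable (ket b *m bra c : 'M_(2 ^ 1)).
Proof.
have comp i j k : ket i *m bra j *m (ket j *m bra k) = ket i *m bra k.
  by rewrite mulmxA -[ket i *m bra j *m ket j]mulmxA bra_ket eqxx mulmx1.
case: (ord2_cases b) => ->; case: (ord2_cases c) => ->.
- by rewrite -(comp 0 1 0); apply: controllableM controllable01 controllable10.
- exact: controllable01.
- exact: controllable10.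
- by rewrite -(comp 1 0 1); apply: controllableM controllable10 controllable01.
Qed.

(** * Block decomposition and induction on the number of qubits *)

(** Splits [D] into four blocks according to the first qubit. Each summand is a product of a matrix
    unit on that qubit and a block on the remaining [n], the shape to which [controllable_qtensr]
    and [controllable_qtensl] apply. *)
Lemma mx_ket_bra_sum n (D : 'M[C]_(2 ^ (1 + n))) :
  D = \sum_b \sum_c
        ((ket b *m bra c) *q (1%:M : 'M_(2 ^ n))) *m
        ((1%:M : 'M_(2 ^ 1)) *q
         ((bra b *q 1%:M) *m D *m (ket c *q 1%:M) : 'M_(2 ^ n))).
Proof.
pose P b : 'M[C]_(2 ^ (1 + n)) := (ket b *m bra b) *q 1%:M.
have P_sum : \sum_b P b = 1%:M.
  by rewrite big_ord_recl big_ord1 -qtensDl -qtens1 -ket_bra_sum;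
    congr ((_ + ket _ *m bra _) *q _); apply: val_inj.
(* The resolution of the identity into the projectors [P b] is inserted on both sides of [D]. *)
rewrite -[LHS]mul1mx -[LHS]mulmx1 -P_sum mulmx_suml mulmx_suml.
apply: eq_bigr => b _; rewrite mulmx_sumr; apply: eq_bigr => c _.
set E := (X in _ = _ *m (_ *q X)).
rewrite (qtens_mul (ket b *m bra c) 1%:M 1%:M) mulmx1 mul1mx.
have -> : (ket b *m bra c) *q E = (ket b *q 1%:M) *m E *m (bra c *q 1%:M).
  by rewrite -ket_qtens (qtens_mul (ket b) E (bra c) 1%:M) mulmx1.
have eP d : P d = (ket d *q 1%:M) *m (bra d *q 1%:M).
  by rewrite (qtens_mul (ket d) 1%:M (bra d)) mulmx1.
by rewrite !eP /E !mulmxA.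
Qed.

Lemma controllable_mx n (D : 'M[C]_(2 ^ n)) : controllable D.
Proof.
elim: n D => [|n IH] D.
  by rewrite [D]mx11_scalar; exact: controllable_scalar.
(* [big_ind] needs the empty sum to be controllable; zero is a scalar matrix. *)
have ctl0 : controllable (0 : 'M[C]_(2 ^ (1 + n))).
  by rewrite -(raddf0 (@scalar_mx C _)); exact: controllable_scalar.
rewrite [D](@mx_ket_bra_sum n); apply: (big_ind (@controllable (1 + n))) => //.
  exact: controllableD.
move=> b _; apply: (big_ind (@controllable (1 + n))) => //.
  exact: controllableD.
move=> c _; apply: (@controllableM (1 + n)); last exact: controllable_qtensl.
exact: controllable_qtensr (controllable_ket_bra b c).
Qed.

End Controlled.

Theorem theorem8p4p9 (R : realType) :
  universal (fun (m n : nat) (A : 'M[R[i]]_(2 ^ m, 2 ^ n)) =>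
    ghz_generator A \/ w_generator A \/ single_qubit_state A).
Proof.
move=> N U _ _; exists 1; split; first exact: normr1.
exact: controllable_constructible (controllable_mx _).
Qed.
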